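(* Let $\mathcal H$ be a real Hilbert space, $S\subset\mathcal H$ a nonempty set, $\varepsilon,\eta>0$, and let $S_\eta\subset\mathcal H$ be a closed set with $S\subset S_\eta\subset S+\eta\mathbb B$. Then, for all $x\in\mathcal H$, $$\operatorname{proj}_S^{\varepsilon}(x)\subset\operatorname{proj}_S^{\varepsilon,\eta}(x)\subset\operatorname{proj}_S^{\varepsilon+2\eta(d_S(x)+\sqrt\varepsilon)+\eta^2}(x)+\eta\mathbb B.$$
   Context: $\mathbb B$ is the closed unit ball of $\mathcal H$; $d_S(x)=\inf_{z\in S}\|x-z\|$. For $\varepsilon>0$, $\operatorname{proj}_S^{\varepsilon}(x):=\{z\in S:\|x-z\|^2<d_S^2(x)+\varepsilon\}$. For $\varepsilon,\eta>0$ and the given set $S_\eta$, $\operatorname{proj}_S^{\varepsilon,\eta}(x):=\{z\in S_\eta:\|x-z\|^2<d_S^2(x)+\varepsilon\}$. *)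

(* Defs.v *)
From HB Require Import structures.
From mathcomp Require Import all_boot all_order all_algebra.
From mathcomp Require Import all_classical all_reals all_analysis.

Set Implicit Arguments.
Unset Strict Implicit.
Unset Printing Implicit Defensive.

Import Order.TTheory GRing.Theory Num.Theory.
Import numFieldNormedType.Exports.

Local Open Scope classical_set_scope.
Local Open Scope ring_scope.

(* Since the conjugation is [idfun], [{dot H for idfun}] is the type of
   symmetric positive definite bilinear forms on [H]. *)
HB.mixin Record CompleteNormedModule_isHilbert (R : realType) H
    of CompleteNormedModule R H := {
  hdot : {dot H for @idfun R} ;
  hnormE : forall u : H, `|u| = Num.sqrt (hdot u u)
}.

#[short(type="hilbertType")]
HB.structure Definition Hilbert (R : realType) :=
  {H of CompleteNormedModule R H & CompleteNormedModule_isHilbert R H}.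

Definition set_add (V : zmodType) (A B : set V) : set V :=
  [set a + b | a in A & b in B].

Definition set_scale (R : pzRingType) (V : lmodType R) (k : R) (A : set V) :
  set V := [set k *: a | a in A].

(* [closed_ballE] identifies this closure of the open unit ball with
   [[set z | `|z| <= 1]]. *)
Definition unit_ball (R : realType) (H : normedModType R) : set H :=
  closed_ball (0 : H) 1.

(* [inf] is the infimum in [R], hence meaningful for nonempty [S] only. *)
Definition dist_set (R : realType) (H : normedModType R) (S : set H) (x : H) :
  R := inf [set `|x - z| | z in S].

Definition proj_approx (R : realType) (H : normedModType R) (S : set H)
    (eps : R) (x : H) : set H :=
  [set z | S z /\ `|x - z| ^+ 2 < dist_set S x ^+ 2 + eps].

(* The candidates [z] range over [Seta], but the distance is the one to [S];
   the parameter [eta] only enters through the choice of [Seta]. *)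
Definition proj_approx_enl (R : realType) (H : normedModType R)
    (S Seta : set H) (eps : R) (x : H) : set H :=
  [set z | Seta z /\ `|x - z| ^+ 2 < dist_set S x ^+ 2 + eps].

(* Main.v *)
Require Import Defs.
From mathcomp Require Import all_boot all_order all_algebra.
From mathcomp Require Import all_classical all_reals all_analysis.
From mathcomp Require Import lra.

Import Order.TTheory GRing.Theory Num.Theory.
Import numFieldNormedType.Exports.

Local Open Scope classical_set_scope.
Local Open Scope ring_scope.

(** The first inclusion only enlarges the set of candidates from [S] to [Seta].
    For the second, a candidate [z] in [Seta] is [a + w] with [a] in [S] and
    [w] of norm at most [eta], so moving from [z] to [a] increases the distance
    to [x] by at most [eta]. Squaring costs the cross term
    [2 * eta * `|x - z|], and [`|x - z| < dist_set S x + Num.sqrt eps] because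
    the square root is subadditive ([lt_add_sqrt]). *)

Lemma dist_set_ge0 {R : realType} {H : normedModType R} {S : set H} (x : H) :
  S !=set0 -> 0 <= dist_set S x.
Proof.
move=> [s Ss]; apply: lb_le_inf; first by exists `|x - s|, s.
by move=> _ [z _ <-].
Qed.

Lemma norm_scale_unit_ball {R : realType} {H : normedModType R} (eta : R)
    (w : H) :
  0 <= eta -> set_scale eta (@unit_ball R H) w -> `|w| <= eta.
Proof.
move=> eta_ge0 [b + <-]; rewrite /unit_ball closed_ballE //.
rewrite /closed_ball_ /= sub0r normrN => b_le1.
by rewrite normrZ ger0_norm // ler_piMr.
Qed.

(** The square of [d + Num.sqrt e] is [d ^+ 2 + e] plus the cross term
    [2 * d * Num.sqrt e], which is nonnegative. *)
Lemma lt_add_sqrt {R : rcfType} {t d e : R} :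
  0 <= d -> 0 <= e -> t ^+ 2 < d ^+ 2 + e -> t < d + Num.sqrt e.
Proof.
move=> d_ge0 e_ge0 t_lt; have s_ge0 := sqrtr_ge0 e.
have sE := sqr_sqrtr e_ge0.
rewrite ltNge; apply/negP => t_ge; nra.
Qed.

(** The point of [S] within [eta] of a candidate [z] is itself an approximate
    projection: the added tolerance bounds the growth of the squared
    distance when [`|x - z|], bounded by [dist_set S x + Num.sqrt eps],
    increases by [eta]. *)
Lemma proj_approx_enl_sub (R : realType) (H : normedModType R)
    (S Seta : set H) (eps eta : R) (x : H) :
  S !=set0 -> 0 <= eps -> 0 <= eta ->
  Seta `<=` set_add S (set_scale eta (@unit_ball R H)) ->
  proj_approx_enl S Seta eps x `<=`
    set_add
      (proj_approx S
         (eps + 2 * eta * (dist_set S x + Num.sqrt eps) + eta ^+ 2) x)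
      (set_scale eta (@unit_ball R H)).
Proof.
move=> S0 eps_ge0 eta_ge0 Seta_sub z [/Seta_sub [a Sa [w w_ball zE]] z_near].
exists a; last by exists w.
split=> //.
have xz_lt := lt_add_sqrt (dist_set_ge0 x S0) eps_ge0 z_near.
have xa_le : `|x - a| <= `|x - z| + eta.
  have -> : x - a = (x - z) + w by rewrite -zE opprD addrA subrK.
  apply: le_trans (ler_normD _ _) _.
  by rewrite lerD2l norm_scale_unit_ball.
have xa_sqr_le : `|x - a| ^+ 2 <= (`|x - z| + eta) ^+ 2.
  by rewrite lerXn2r ?nnegrE ?addr_ge0.
have cross_le : eta * `|x - z| <= eta * (dist_set S x + Num.sqrt eps).
  by rewrite ler_wpM2l // ltW.
lra.
Qed.

Theorem proposition2p7 (R : realType) (H : hilbertType R) (S Seta : set H)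
    (eps eta : R) (S_nonempty : S !=set0) (eps_gt0 : 0 < eps)
    (eta_gt0 : 0 < eta) (Seta_closed : closed Seta) (S_sub_Seta : S `<=` Seta)
    (Seta_sub : Seta `<=` set_add S (set_scale eta (@unit_ball R H))) :
  forall x : H,
    proj_approx S eps x `<=` proj_approx_enl S Seta eps x /\
    proj_approx_enl S Seta eps x `<=`
      set_add
        (proj_approx S
           (eps + 2 * eta * (dist_set S x + Num.sqrt eps) + eta ^+ 2) x)
        (set_scale eta (@unit_ball R H)).
Proof.
move=> x; split; first by move=> z [/S_sub_Seta].
by apply: proj_approx_enl_sub => //; exact: ltW.
Qed.
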